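(* There is an absolute constant $C$ such that for all positive integers $n$, $F_2(n)\ge \frac{n}{4}-C$. Consequently, $F^{\mathrm{weak}}(n)\ge \frac n4 - C$ for all $n$.
   Context: For a positive integer $n$, $[n]=\{1,\dots,n\}$ and $[n]^{(2)}$ is the set of $2$-element subsets of $[n]$. $\mathcal{C}_{n;r}$ is the set of all maps $c:[n]^{(2)}\to[r]$. For such $c$, a twin of size $\ell$ is a pair of disjoint sets $I=\{i_1<\dots<i_\ell\}$, $J=\{j_1<\dots<j_\ell\}\subset[n]$ with $c(\{i_t,i_{t+1}\})=c(\{j_t,j_{t+1}\})$ for all $t=1,\dots,\ell-1$; $f(c)$ is the maximum size of a twin of $c$, and $F_r(n)=\min_{c\in\mathcal{C}_{n;r}}f(c)$. For $\pi\in S_n$, a weak-twin of $\pi$ is a pair of disjoint sets $I=\{i_1<\dots<i_\ell\}$, $J=\{j_1<\dots<j_\ell\}\subset[n]$ such that for each $t\in[\ell-1]$, $\pi(i_t)<\pi(i_{t+1})$ if and only if $\pi(j_t)<\pi(j_{t+1})$; $f^{\mathrm{weak}}(\pi)$ is the largest $\ell$ such that $\pi$ has a weak-twin with $|I|=\ell$, and $F^{\mathrm{weak}}(n)=\min_{\pi\in S_n}f^{\mathrm{weak}}(\pi)$. *)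

(* Defs.v *)
From HB Require Import structures.
From mathcomp Require Import all_boot all_order all_algebra all_fingroup.

Set Implicit Arguments.
Unset Strict Implicit.
Unset Printing Implicit Defensive.

(* The set [n] = {1, ..., n} is modelled by 'I_n = {0, ..., n-1}, and [r] by
   'I_r; only the order of the vertices matters. *)

Definition edge (n : nat) := {e : {set 'I_n} | #|e| == 2}.

Definition coloring (n r : nat) := {ffun edge n -> 'I_r}.

(* c({x, y}), as an option: it is Some (c {x, y}) if x != y and None if x = y
   (see pair_colorE); below it is only used for distinct x and y. *)
Definition pair_color n r (c : coloring n r) (x y : 'I_n) : option 'I_r :=
  omap c (insub [set x; y]).

(* enum I lists I = {i_1 < ... < i_l} in increasing order (sorted_enum_set), so
   nth x0 (enum I) t is i_(t+1).  The default x0 is never reached, as t.+1 is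
   smaller than the common cardinal; it is quantified over because 'I_n has no
   distinguished element.  The bound t : 'I_n loses nothing, as #|I| <= n. *)
Definition twin n r (c : coloring n r) (I J : {set 'I_n}) : bool :=
  [&& [disjoint I & J], #|I| == #|J| &
      [forall x0 : 'I_n, forall t : 'I_n, (t.+1 < #|I|) ==>
        (pair_color c (nth x0 (enum I) t) (nth x0 (enum I) t.+1) ==
         pair_color c (nth x0 (enum J) t) (nth x0 (enum J) t.+1))]].

Definition max_twin n r (c : coloring n r) : nat :=
  \max_(p : {set 'I_n} * {set 'I_n} | twin c p.1 p.2) #|p.1|.

(* The initial value n of the minimum is neutral because max_twin c <= n; the
   minimum is attained as soon as r > 0 (twin_number_attained). *)
Definition twin_number (r n : nat) : nat :=
  \big[minn/n]_(c : coloring n r) max_twin c.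

Definition weak_twin n (s : {perm 'I_n}) (I J : {set 'I_n}) : bool :=
  [&& [disjoint I & J], #|I| == #|J| &
      [forall x0 : 'I_n, forall t : 'I_n, (t.+1 < #|I|) ==>
        ((s (nth x0 (enum I) t) < s (nth x0 (enum I) t.+1)) ==
         (s (nth x0 (enum J) t) < s (nth x0 (enum J) t.+1)))]].

Definition max_weak_twin n (s : {perm 'I_n}) : nat :=
  \max_(p : {set 'I_n} * {set 'I_n} | weak_twin s p.1 p.2) #|p.1|.

Definition weak_twin_number (n : nat) : nat :=
  \big[minn/n]_(s : {perm 'I_n}) max_weak_twin s.

Lemma pair_colorE n r (c : coloring n r) (x y : 'I_n)
    (xy : #|[set x; y]| == 2) :
  pair_color c x y = Some (c (exist _ [set x; y] xy)).
Proof.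
rewrite /pair_color (insubT (fun e : {set 'I_n} => #|e| == 2) xy) /=.
by congr (Some (c _)); apply: val_inj.
Qed.

Lemma sorted_enum_set n (I : {set 'I_n}) : sorted ltn (map val (enum I)).
Proof.
apply: (subseq_sorted ltn_trans) (iota_ltn_sorted 0 n).
rewrite -val_enum_ord; apply: map_subseq.
by rewrite [enum 'I_n]enumT /enum_mem filter_subseq.
Qed.

Lemma max_twin_le n r (c : coloring n r) : max_twin c <= n.
Proof.
by apply/bigmax_leqP => p _; rewrite -[leqRHS]card_ord max_card.
Qed.

Lemma max_weak_twin_le n (s : {perm 'I_n}) : max_weak_twin s <= n.
Proof.
by apply/bigmax_leqP => p _; rewrite -[leqRHS]card_ord max_card.
Qed.

Lemma bigmin_attained (T : finType) (x0 : T) n (g : T -> nat) :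
  (forall x, g x <= n) ->
  (exists x, \big[minn/n]_(y : T) g y = g x) /\
  (forall x, \big[minn/n]_(y : T) g y <= g x).
Proof.
move=> gn.
have le x : \big[minn/n]_(y : T) g y <= g x.
  elim: (index_enum T) (mem_index_enum x) => // y s IH.
  by rewrite big_cons inE geq_min => /predU1P[<-|/IH ->]; rewrite ?leqnn ?orbT.
split=> //; case: (arg_minnP g (isT : xpredT x0)) => x _ xmin.
exists x; apply/eqP; rewrite eqn_leq le /=.
by elim/big_ind: _ => [|a b xa xb|y _]; rewrite ?gn ?leq_min ?xa ?xb ?xmin.
Qed.

Lemma twin_number_attained r n : 0 < r ->
  (exists c : coloring n r, twin_number r n = max_twin c) /\
  (forall c : coloring n r, twin_number r n <= max_twin c).
Proof.
move=> r0; apply: bigmin_attained (@max_twin_le n r).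
exact: [ffun=> Ordinal r0].
Qed.

Lemma weak_twin_number_attained n :
  (exists s : {perm 'I_n}, weak_twin_number n = max_weak_twin s) /\
  (forall s : {perm 'I_n}, weak_twin_number n <= max_weak_twin s).
Proof. exact: (bigmin_attained 1%g (@max_weak_twin_le n)). Qed.

(* Main.v *)
(* Write f x y for the colour of the pair x < y, and call x and y l-adjacent if
   they are the last elements of a twin of size l + 1.
   If x and y are l-adjacent and u, v come later, then u and v are (l + 1)-adjacent
   as soon as f x u = f y v or f y u = f x v.  For an l-triangle, this can only
   fail if it sends one colour to u and the opposite colour to v.
   By induction on l, one of two situations occurs among the first 4 l + 3
   vertices: (a) an l-triangle, or (b) two l-adjacent pairs such that every later
   vertex completes one of them to an l-triangle.
   From (a), look at how the triangle sees the next four vertices: either three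
   of them form an (l + 1)-triangle, or two are purely of one colour and two
   purely of the other, which gives (b).
   From (b), let m be the next vertex, x y m the l-triangle that it completes, and
   look at how this triangle sees the three vertices after m.  If they do not form
   an (l + 1)-triangle, then two of them, v and w, are purely of opposite colours.
   If the third one sees both colours, its pairs with v and with w give (b).
   Otherwise it has the colour b of v, say, and w has colour ~~ b; if both x and y
   send b to m, then m forms a triangle with the two vertices of colour b, and if
   not, m is adjacent to w and to all later vertices of colour ~~ b, so (b). *)

Require Import Defs.
From HB Require Import structures.
From mathcomp Require Import all_boot all_order all_algebra all_fingroup.
From mathcomp Require Import zify lra.
Set Implicit Arguments.
Unset Strict Implicit.
Unset Printing Implicit Defensive.

Import Order.TTheory GRing.Theory Num.Theory.

(** * Twins grown from their last elements *)

Section TwinEnds.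

Variable f : nat -> nat -> bool.

(* [twin_ends l x y]: some twin of size l.+1 has the last elements x and y, and
   each of its steps goes beyond both previous elements, so that I and J are
   automatically disjoint. *)
Inductive twin_ends : nat -> nat -> nat -> Prop :=
| TwinEnds0 x y : x != y -> twin_ends 0 x y
| TwinEndsS l x y u v :
    twin_ends l x y -> maxn x y < minn u v -> u != v -> f x u = f y v ->
    twin_ends l.+1 u v.

Lemma twin_ends_sym l x y : twin_ends l x y -> twin_ends l y x.
Proof.
elim=> {l x y} [x y xy|l x y u v _ IH lt uv e]; first by constructor; rewrite eq_sym.
by apply: (TwinEndsS IH); rewrite 1?maxnC 1?minnC 1?eq_sym.
Qed.

Lemma twin_ends_step l x y m u v : twin_ends l x y ->
  x < m -> y < m -> m <= u -> m <= v -> u != v ->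
  (f x u == f y v) || (f y u == f x v) -> twin_ends l.+1 u v.
Proof.
move=> xy xm ym mu mv uv /orP[] /eqP e.
  by apply: (TwinEndsS xy) => //; lia.
by apply: (TwinEndsS (twin_ends_sym xy)) => //; lia.
Qed.

Lemma twin_ends_paths l x y : twin_ends l x y ->
  exists s t : seq nat,
    [/\ sorted ltn (rcons s x), sorted ltn (rcons t y), size s = l, size t = l &
        ~~ has (mem (rcons t y)) (rcons s x)] /\
    forall i, i < l -> f (nth 0 (rcons s x) i) (nth 0 (rcons s x) i.+1) =
                       f (nth 0 (rcons t y) i) (nth 0 (rcons t y) i.+1).
Proof.
(* Strengthened for the induction: all entries are at most [maxn x y], so the next pair [u], [v] is
   new to both paths. *)
move=> xy; suff: exists s t : seq nat,
    [/\ sorted ltn (rcons s x), sorted ltn (rcons t y), size s = l, size t = l &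
        ~~ has (mem (rcons t y)) (rcons s x)] /\
    [/\ forall i, i < l -> f (nth 0 (rcons s x) i) (nth 0 (rcons s x) i.+1) =
                           f (nth 0 (rcons t y) i) (nth 0 (rcons t y) i.+1),
        all (leq^~ (maxn x y)) (rcons s x) & all (leq^~ (maxn x y)) (rcons t y)].
  by move=> [s [t [p [q _ _]]]]; exists s, t.
elim: xy => {l x y} [x y xy|l x y u v _ [s [t [[ss st zs zt dis] [col bs bt]]]] lt uv e].
  by exists [::], [::]; split; split=> //=; rewrite ?inE ?orbF ?andbT ?leq_max ?leqnn ?orbT.
have old w (r : seq nat) : maxn x y < w -> all (leq^~ (maxn x y)) r -> all (ltn^~ w) r.
  by move=> mw; apply: sub_all => i /leq_ltn_trans; apply.
have [mu mv] : maxn x y < u /\ maxn x y < v by lia.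
have new w (r : seq nat) : maxn x y < w -> all (leq^~ (maxn x y)) r -> w \notin r.
  by move=> mw /(old _ _ mw) /allP lt_r; apply/negP => /lt_r /=; rewrite ltnn.
have up (r : seq nat) : all (leq^~ (maxn x y)) r -> all (leq^~ (maxn u v)) r.
  by apply: sub_all => i /= im; lia.
exists (rcons s x), (rcons t y); split; split.
- rewrite (sorted_pairwise ltn_trans) pairwise_rcons old //.
  by rewrite -(sorted_pairwise ltn_trans).
- rewrite (sorted_pairwise ltn_trans) pairwise_rcons old //.
  by rewrite -(sorted_pairwise ltn_trans).
- by rewrite size_rcons zs.
- by rewrite size_rcons zt.
- rewrite has_rcons /= mem_rcons inE (negPf uv) (negPf (new _ _ mu bt)) /=.
  apply/hasPn => i ir; rewrite /= mem_rcons inE negb_or (hasPn dis) // andbT.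
  by apply: contraTneq ir => ->; apply: new bs.
- move=> i; rewrite ltnS leq_eqVlt => /predU1P[->|il]; last first.
    by rewrite !(nth_rcons _ (rcons _ _)) !size_rcons zs zt !ltnS il ltnW // col.
  rewrite !(nth_rcons _ (rcons _ _)) !size_rcons zs zt ltnSn ltnn eqxx.
  by rewrite -{1}zs -zt !nth_rcons zs zt !ltnn !eqxx.
- by rewrite all_rcons up // andbT leq_max leqnn.
- by rewrite all_rcons up // andbT leq_max leqnn orbT.
Qed.

(** * Triangles and the colours they send forward *)

Definition kind x y z u : option bool :=
  if (f x u == f y u) && (f y u == f z u) then Some (f x u) else None.

Definition opposed (a b : option bool) : bool :=
  if a is Some a' then b == Some (~~ a') else false.

Definition triangle l x y z :=
  [/\ twin_ends l x y, twin_ends l x z & twin_ends l y z].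

(** If [f p u] differs from [f q v] for all distinct corners [p], [q], then all corners send one
    colour to [u] and the other to [v]. *)
Lemma triangle_step l m x y z u v : triangle l x y z ->
  x < m -> y < m -> z < m -> m <= u -> m <= v -> u != v ->
  ~~ opposed (kind x y z u) (kind x y z v) -> twin_ends l.+1 u v.
Proof.
move=> [xy xz yz] xm ym zm mu mv uv.
have := twin_ends_step xy xm ym mu mv uv; have := twin_ends_step xz xm zm mu mv uv.
have := twin_ends_step yz ym zm mu mv uv; rewrite /kind.
case: (f x u) (f y u) (f z u) (f x v) (f y v) (f z v) => [] [] [] [] [] [] //=; auto.
Qed.

(** The two pairs of the second case may share a vertex. *)
Definition good l m :=
  (exists x y z, [/\ x < m, y < m, z < m & triangle l x y z]) \/
  (exists x y z w, [/\ x < m, y < m, z < m & w < m] /\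
     [/\ twin_ends l x y, twin_ends l z w & forall u, m <= u ->
         triangle l x y u \/ triangle l z w u]).

Lemma good_triangle_step l m x y z : triangle l x y z ->
  x < m -> y < m -> z < m -> good l.+1 (m + 4).
Proof.
move=> T xm ym zm.
have E u v := @triangle_step l m x y z u v T xm ym zm.
have Em i j : i != j -> ~~ opposed (kind x y z (m + i)) (kind x y z (m + j)) ->
  twin_ends l.+1 (m + i) (m + j) by move=> ij; apply: E; lia.
have tri i j k : [&& i < 4, j < 4 & k < 4] -> [&& i != j, i != k & j != k] ->
    [&& ~~ opposed (kind x y z (m + i)) (kind x y z (m + j)),
        ~~ opposed (kind x y z (m + i)) (kind x y z (m + k)) &
        ~~ opposed (kind x y z (m + j)) (kind x y z (m + k))] -> good l.+1 (m + 4).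
  move=> /and3P[i4 j4 k4] /and3P[ij ik jk] /and3P[oij oik ojk].
  left; exists (m + i), (m + j), (m + k); split; [lia..|].
  by split; apply: Em.
have quad i j k h b : [&& i < 4, j < 4, k < 4 & h < 4] -> (i != j) && (k != h) ->
    [&& kind x y z (m + i) == Some b, kind x y z (m + j) == Some b,
        kind x y z (m + k) == Some (~~ b) & kind x y z (m + h) == Some (~~ b)] ->
    good l.+1 (m + 4).
  move=> /and4P[i4 j4 k4 h4] /andP[ij kh] /and4P[/eqP ki /eqP kj /eqP kk /eqP kh'].
  right; exists (m + i), (m + j), (m + k), (m + h); split; first by split; lia.
  split=> [||u mu]; [by apply: Em => //; rewrite ?ki ?kj ?kk ?kh' /=; case: (b)..|].
  (* A vertex cannot be opposed to both [Some b] and [Some (~~ b)]. *)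
  case: (boolP (kind x y z u == Some (~~ b))) => ku; [right|left]; split;
    apply: E; rewrite ?ki ?kj ?kk ?kh' ?(eqP ku) /=; try lia; try by case: (b).
move: (tri 0 1 2) (tri 0 1 3) (tri 0 2 3) (tri 1 2 3) => t1 t2 t3 t4.
move: (quad 0 1 2 3) (quad 0 2 1 3) (quad 0 3 1 2) => q1 q2 q3.
move: t1 t2 t3 t4 (q1 true) (q2 true) (q3 true) (q1 false) (q2 false) (q3 false).
by move: (kind x y z (m + 0)) (kind x y z (m + 1)) (kind x y z (m + 2))
  (kind x y z (m + 3)) => [[]|] [[]|] [[]|] [[]|] /=; auto.
Qed.

Lemma kindP x y z u b : kind x y z u = Some b -> f x u = b /\ f y u = b.
Proof. by rewrite /kind; case: eqP => //= -> ; case: ifP => // _ [->]. Qed.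

Lemma good_pair_step l m x y : triangle l x y m -> x < m -> y < m -> good l.+1 (m + 4).
Proof.
move=> T xm ym; have xy : twin_ends l x y by case: T.
have E u v : m < u -> m < v -> u != v ->
    ~~ opposed (kind x y m u) (kind x y m v) -> twin_ends l.+1 u v.
  by move=> mu mv; apply: (triangle_step T _ _ _ mu mv); lia.
(* Here [m] is itself a new last element, so only the pair [x], [y] can be extended. *)
have E0 u : m < u -> (f x m == f y u) || (f y m == f x u) -> twin_ends l.+1 m u.
  by move=> mu; apply: (twin_ends_step xy xm ym); lia.
have Em i j : [&& 0 < i, 0 < j & i != j] ->
    ~~ opposed (kind x y m (m + i)) (kind x y m (m + j)) ->
    twin_ends l.+1 (m + i) (m + j).
  by move=> /and3P[i0 j0 ij]; apply: E; lia.
have tri : ~~ opposed (kind x y m (m + 1)) (kind x y m (m + 2)) ->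
    ~~ opposed (kind x y m (m + 1)) (kind x y m (m + 3)) ->
    ~~ opposed (kind x y m (m + 2)) (kind x y m (m + 3)) -> good l.+1 (m + 4).
  move=> o12 o13 o23; left; exists (m + 1), (m + 2), (m + 3).
  by split; [lia..|split; apply: Em].
pose distinct i j k :=
  [&& 0 < i < 4, 0 < j < 4, 0 < k < 4, i != j & (i != k) && (j != k)].
have away i j k : distinct i j k ->
    [/\ m < m + i, m < m + j & m < m + k] /\
    [/\ m + i < m + 4, m + j < m + 4 & m + k < m + 4] /\
    [/\ m + i != m + j, m + i != m + k & m + j != m + k].
  by rewrite /distinct => d; do !split; lia.
have later v u : v < m + 4 -> m + 4 <= u -> v != u.
  by move=> vm mu; rewrite ltn_eqF // (leq_trans vm).
have above u : m + 4 <= u -> m < u by lia.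
have mixed i j k b : distinct i j k -> kind x y m (m + i) = Some b ->
    kind x y m (m + j) = None -> kind x y m (m + k) = Some (~~ b) -> good l.+1 (m + 4).
  move=> /away[[mi mj mk] [[im jm km] [ij ik jk]]] ki kj kk; right.
  exists (m + i), (m + j), (m + j), (m + k); split=> //.
  have [Eij Ejk] : twin_ends l.+1 (m + i) (m + j) /\ twin_ends l.+1 (m + j) (m + k).
    by split; apply: E; rewrite ?ki ?kj.
  split=> // u mu; have [um iu ju ku] := And4 (above _ mu) (later _ _ im mu)
    (later _ _ jm mu) (later _ _ km mu).
  by case: (boolP (kind x y m u == Some (~~ b))) => [/eqP|] uk; [right|left]; split=> //;
    apply: E; rewrite // ?ki ?kj ?kk ?uk //=; case: (b).
have two i j k b : distinct i j k -> kind x y m (m + i) = Some b ->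
    kind x y m (m + j) = Some b -> kind x y m (m + k) = Some (~~ b) ->
    good l.+1 (m + 4).
  move=> /away[[mi mj mk] [[im jm km] [ij ik jk]]] ki kj kk.
  have [xi yi] := kindP ki; have [xj yj] := kindP kj; have [xk yk] := kindP kk.
  have mm : m < m + 4 by exact: leq_trans mi (ltnW im).
  have Eij : twin_ends l.+1 (m + i) (m + j).
    by apply: E; rewrite // ?ki ?kj /=; case: (b).
  have [/andP[/eqP fx /eqP fy]|nb] := boolP ((f x m == b) && (f y m == b)).
    left; exists m, (m + i), (m + j); split=> //; split=> //.
      by apply: E0; rewrite // fx yi eqxx.
    by apply: E0; rewrite // fx yj eqxx.
  have {}nb : (f x m == ~~ b) || (f y m == ~~ b).
    by move: nb; case: (f x m) (f y m) (b) => [] [] [].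
  (* Both [x] and [y] send [~~ b] to [m + k], so either alternative of [nb] suffices. *)
  have Ek : twin_ends l.+1 m (m + k) by apply: E0; rewrite // xk yk.
  right; exists (m + i), (m + j), m, (m + k); split=> //; split=> // u mu.
  have [um iu ju ku] := And4 (above _ mu) (later _ _ im mu)
    (later _ _ jm mu) (later _ _ km mu).
  case: (boolP (kind x y m u == Some (~~ b))) => [/eqP uk|uk]; [right|left]; split=> //.
  - by have [xu yu] := kindP uk; apply: E0; rewrite // xu yu.
  - by apply: E; rewrite // ?kk ?uk /=; case: (b).
  - by apply: E; rewrite // ?ki.
  - by apply: E; rewrite // ?kj.
move: (mixed 1 2 3) (mixed 1 3 2) (mixed 2 1 3) => m1 m2 m3.
move: (two 1 2 3) (two 1 3 2) (two 2 3 1) => t1 t2 t3.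
move: tri (m1 true) (m2 true) (m3 true) (m1 false) (m2 false) (m3 false)
  (t1 true) (t2 true) (t3 true) (t1 false) (t2 false) (t3 false).
by move: (kind x y m (m + 1)) (kind x y m (m + 2)) (kind x y m (m + 3))
  => [[]|] [[]|] [[]|] /=; auto.
Qed.

(** Three vertices start the induction, and each further step of the twin costs four. *)
Lemma goodP l : good l (3 + 4 * l).
Proof.
elim: l => [|l [[x [y [z [xm ym zm T]]]]|[x [y [z [w [[xm ym zm wm] [xy zw ext]]]]]]]].
- by left; exists 0, 1, 2; split=> //; split; constructor.
- by rewrite mulnSr addnA; apply: good_triangle_step T xm ym zm.
- rewrite mulnSr addnA.
  case: (ext _ (leqnn _)) => T; first exact: good_pair_step T xm ym.
  exact: good_pair_step T zm wm.
Qed.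

Lemma good_twin_ends l m : good l m -> exists x y, [/\ x < m, y < m & twin_ends l x y].
Proof.
case=> [[x [y [z [xm ym _ [xy _ _]]]]]|[x [y [z [w [[xm ym _ _] [xy _ _]]]]]]];
  by exists x, y.
Qed.

End TwinEnds.

(** * From paths of numbers to sets, colourings and permutations *)

Lemma twins_of_relation n (g : rel 'I_n) : exists I J : {set 'I_n},
  [/\ [disjoint I & J], #|I| = #|J|, n <= 4 * #|I| + 4 &
      forall (x0 : 'I_n) t, t.+1 < #|I| ->
        g (nth x0 (enum I) t) (nth x0 (enum I) t.+1) =
        g (nth x0 (enum J) t) (nth x0 (enum J) t.+1)].
Proof.
have [n3|n3] := ltnP n 3.
  exists set0, set0; split=> //; rewrite ?cards0 //; last by lia.
  by rewrite -setI_eq0 setI0.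
(* The default [false] is never met on the paths, which stay below [n]. *)
pose f i j := if (insub i, insub j) is (Some a, Some b) then g a b else false.
(* The largest [l] with [3 + 4 * l <= n]; the twin has size [l.+1]. *)
pose l := (n - 3) %/ 4.
have [x [y [xn yn /twin_ends_paths[s [t [[ss st zs zt dis] col]]]]]] :
    exists x y, [/\ x < n, y < n & twin_ends f l x y].
  have [x [y [xm ym xy]]] := good_twin_ends (goodP f l).
  by exists x, y; split=> //; lia.
have toset (r : seq nat) w : sorted ltn (rcons r w) -> w < n ->
    map val (enum [set i : 'I_n | val i \in rcons r w]) = rcons r w.
  move=> sr wn; apply: (irr_sorted_eq ltn_trans ltnn) => // [|i].
    exact: sorted_enum_set.
  apply/mapP/idP => [[j]|ir]; first by rewrite mem_enum inE => jr ->.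
  have i_n : i < n.
    move: ir sr; rewrite mem_rcons inE (sorted_pairwise ltn_trans) pairwise_rcons.
    case/predU1P => [->//|ir /andP[/allP/(_ i ir) iw _]].
    exact: ltn_trans iw wn.
  by exists (Ordinal i_n) => //; rewrite mem_enum inE.
pose set_of (r : seq nat) w := [set i : 'I_n | val i \in rcons r w].
have cardset r w : sorted ltn (rcons r w) -> w < n -> #|set_of r w| = (size r).+1.
  by move=> sr wn; rewrite cardE -(size_map val) toset // size_rcons.
have colset r w (x0 : 'I_n) i : sorted ltn (rcons r w) -> w < n -> i < size r ->
    g (nth x0 (enum (set_of r w)) i) (nth x0 (enum (set_of r w)) i.+1) =
    f (nth 0 (rcons r w) i) (nth 0 (rcons r w) i.+1).
  move=> sr wn ir; rewrite -(toset r w sr wn).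
  rewrite !(nth_map x0) -?cardE ?cardset //; last exact: ltnW.
  by rewrite /f !valK.
exists (set_of s x), (set_of t y); split.
- by rewrite disjoint_subset; apply/subsetP => i; rewrite !inE => /(hasPn dis).
- by rewrite !cardset // zs zt.
- by rewrite cardset // zs; lia.
- move=> x0 i; rewrite cardset // ltnS => il.
  by rewrite !colset ?zt -?zs // col // -zs.
Qed.

Lemma leq_twin_number n : n <= 4 * twin_number 2 n + 4.
Proof.
have [[c ->] _] := twin_number_attained (r := 2) n isT.
pose g (a b : 'I_n) := pair_color c a b == Some ord0.
have [I [J [dis IJ nI col]]] := twins_of_relation g.
apply: leq_trans nI _; rewrite leq_add2r leq_mul2l /=.
apply: (@leq_bigmax_cond _ _ (fun p : {set 'I_n} * {set 'I_n} => #|p.1|) (I, J)) => /=.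
apply/and3P; split=> //; first exact/eqP.
apply/forallP => x0; apply/forallP => t; apply/implyP => tI.
(* [g] is false both on colour 1 and on [None]; consecutive elements are distinct, which excludes
   [None]. *)
have colored (A : {set 'I_n}) : t.+1 < #|A| ->
    exists a, pair_color c (nth x0 (enum A) t) (nth x0 (enum A) t.+1) = Some a.
  move=> tA; set a := nth _ _ _; set b := nth _ _ _.
  suff ab : #|[set a; b]| == 2 by rewrite pair_colorE; eexists.
  rewrite cards2 nth_uniq -?cardE ?enum_uniq //; last exact: ltnW.
  by rewrite neq_ltn ltnSn.
move: (col x0 t tI); rewrite /g.
have [a ->] := colored I tI.
have [b ->] := colored J (etrans (congr1 (fun k => t.+1 < k) (esym IJ)) tI).
by case: a => [[|[|?]] ?]; case: b => [[|[|?]] ?].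
Qed.

Lemma leq_weak_twin_number n : n <= 4 * weak_twin_number n + 4.
Proof.
have [[s ->] _] := weak_twin_number_attained n.
have [I [J [dis IJ nI col]]] := twins_of_relation (fun a b : 'I_n => s a < s b).
apply: leq_trans nI _; rewrite leq_add2r leq_mul2l /=.
apply: (@leq_bigmax_cond _ _ (fun p : {set 'I_n} * {set 'I_n} => #|p.1|) (I, J)) => /=.
apply/and3P; split=> //; first exact/eqP.
apply/forallP => x0; apply/forallP => t; apply/implyP => tI.
by apply/eqP/col.
Qed.

Local Open Scope ring_scope.

Theorem theorem2 :
  exists C : rat,
    (forall n : nat, (0 < n)%N ->
       n%:R / 4%:R - C <= (twin_number 2 n)%:R :> rat) /\
    (forall n : nat, (0 < n)%N ->
       n%:R / 4%:R - C <= (weak_twin_number n)%:R :> rat).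
Proof.
have bound (n k : nat) : (n <= 4 * k + 4)%N -> n%:R / 4%:R - 1 <= k%:R :> rat.
  by rewrite -(ler_nat rat) natrD natrM => nk; lra.
exists 1; split=> n _; apply: bound.
- exact: leq_twin_number.
- exact: leq_weak_twin_number.
Qed.
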